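(* In the Gaussian sequential learning model described in the context with smooth randomized response and privacy budget $\varepsilon\in(0,\infty)$, let $C(\varepsilon)=\frac{\varepsilon\sigma^2}{4}\left(e^{\varepsilon+\frac{\varepsilon^2\sigma^2}{2}}-e^{-\varepsilon+\frac{\varepsilon^2\sigma^2}{2}}\right)$ and $f(n)=\frac{2}{\varepsilon\sigma^2}\log(C(\varepsilon)n)$. Then, conditional on $\theta=+1$, $\lim_{n\to\infty} l_n/f(n)=1$ with probability $1$; in particular $f(n)\sim\frac{2}{\varepsilon\sigma^2}\log n$.
   Context: Gaussian model: unknown state $\theta\in\{-1,+1\}$ with uniform prior; agents $n=1,2,\dots$ act in sequence; agent $n$ privately observes $s_n\sim\mathcal{N}(\theta,\sigma^2)$, i.i.d. given $\theta$, $\sigma>0$. The public log-likelihood ratio is $l_n=\log\frac{\mathbb{P}(\theta=+1\mid x_1,\dots,x_{n-1})}{\mathbb{P}(\theta=-1\mid x_1,\dots,x_{n-1})}$, $l_1=0$, where $x_i\in\{-1,+1\}$ are reported actions. With $t(l)=-\sigma^2l/2$, agent $n$'s intended action is $a_n=+1$ if $s_n>t(l_n)$, else $-1$; under smooth randomized response she reports $x_n=a_n$ with probability $1-u_n(s_n)$ and $x_n=-a_n$ with probability $u_n(s_n)=\frac12e^{-\varepsilon|s_n-t(l_n)|}$. Thus $l_{n+1}=l_n+\log\frac{\mathbb{P}(x_n\mid l_n,\theta=+1)}{\mathbb{P}(x_n\mid l_n,\theta=-1)}$ where $\mathbb{P}(x_n=+1\mid l,\theta)=\int_{\mathbb{R}}\phi_\theta(s)\big[\mathbf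 1\{s>t(l)\}(1-\tfrac12e^{-\varepsilon|s-t(l)|})+\mathbf 1\{s\le t(l)\}\tfrac12e^{-\varepsilon|s-t(l)|}\big]ds$ with $\phi_\theta$ the $\mathcal{N}(\theta,\sigma^2)$ density. Notation $f\sim g$ means $f(n)/g(n)\to1$. *)

(* Defs.v *)
From HB Require Import structures.
From mathcomp Require Import all_boot all_order all_algebra.
From mathcomp Require Import finmap.
From mathcomp Require Import all_classical all_reals all_analysis.
Set Implicit Arguments. Unset Strict Implicit. Unset Printing Implicit Defensive.
Import Order.TTheory GRing.Theory Num.Theory.
Import numFieldNormedType.Exports.
Local Open Scope classical_set_scope.
Local Open Scope ring_scope.

Section GaussModel.
Context {R : realType}.
Variables (eps sigma : R).

Definition thr (l : R) : R := - (sigma ^+ 2 * l / 2).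

Definition flipp (l s : R) : R := expR (- (eps * `|s - thr l|)) / 2.

Definition report_plus_given (l s : R) : R :=
  if thr l < s then 1 - flipp l s else flipp l s.

Definition pplus (theta l : R) : R :=
  Rintegral lebesgue_measure setT
    (fun s => normal_pdf theta sigma s * report_plus_given l s).

Definition pact (x : bool) (theta l : R) : R :=
  if x then pplus theta l else 1 - pplus theta l.

Definition llr_incr (l : R) (x : bool) : R :=
  ln (pact x 1 l / pact x (-1) l).

(* reported action of an agent with signal s, public llr l and
   randomization variable v (uniform on [0,1]): intended action
   a = +1 iff s > t(l); it is flipped iff v < u(s), i.e. w.p. u(s). *)
Definition report (l s v : R) : bool :=
  let a := thr l < s in if v < flipp l s then ~~ a else a.

(* public llr l_n for n >= 1 (l_0 is an unused dummy), l_1 = 0,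
   l_{n+1} = l_n + log(P(x_n|l_n,+1)/P(x_n|l_n,-1)) *)
Fixpoint lpub (s v : nat -> R) (n : nat) : R :=
  match n with
  | 0%N => 0
  | S m => match m with
           | 0%N => 0
           | _ => lpub s v m + llr_incr (lpub s v m) (report (lpub s v m) (s m) (v m))
           end
  end.

Definition Cconst : R :=
  eps * sigma ^+ 2 / 4 *
  (expR (eps + eps ^+ 2 * sigma ^+ 2 / 2) - expR (- eps + eps ^+ 2 * sigma ^+ 2 / 2)).

Definition fn (n : nat) : R := 2 / (eps * sigma ^+ 2) * ln (Cconst * n%:R).

End GaussModel.

Definition mutually_independent {d} {T : measurableType d} {R : realType}
  (P : probability T R) {I : choiceType} (X : I -> T -> R) : Prop :=
  forall (J : {fset I}) (B : I -> set R),
    (forall i, i \in J -> measurable (B i)) ->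
    P (\bigcap_(i in [set` J]) (X i @^-1` B i)) =
    (\prod_(i <- J) P (X i @^-1` B i))%E.

(* Main.v *)
(* Write kappa = eps * sigma ^+ 2 / 2. For large l both states lead to a report
   of -1 with probability of order expR (- kappa * l), so a report of +1 raises
   the public log-likelihood ratio l by O(expR (- kappa * l)), while a report of
   -1 lowers it by about 2 * eps. Hence expR (kappa * l_n) grows at most linearly,
   surely, which is the upper bound l_n <= ln n / kappa + O(1).

   Reports of -1 occur infinitely often (their conditional probability is of order
   1 / n), so the lower bound is probabilistic. The Hellinger affinity of the two
   conditional laws of a report is at most 1 - a * expR (- kappa * l), so with
   beta = 1 / (2 * kappa) and z = ln n - kappa * l_n the process
   n `^ (- eta) * (K + expR (beta * z)) is a supermartingale as long as l_n stays
   bounded below; the martingale expR (- l_n) controls the latter. A maximal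
   inequality, obtained by induction over finite histories of reports, then gives
   almost surely z <= D + r * ln n for every r > 0. *)

Require Import Defs.
From HB Require Import structures.
From mathcomp Require Import all_boot all_order all_algebra.
From mathcomp Require Import finmap.
From mathcomp Require Import all_classical all_reals all_analysis.
From mathcomp Require Import measurable_realfun ring lra.
Import Order.TTheory GRing.Theory Num.Theory.
Import numFieldNormedType.Exports.
Local Open Scope classical_set_scope.
Local Open Scope ring_scope.
Set Implicit Arguments.
Unset Strict Implicit.
Unset Printing Implicit Defensive.

(** * Gaussian integrals *)

Section gaussian_integrals.
Context {R : realType}.
Implicit Types (f g : R -> R) (m x c sigma : R).
Local Notation mu := (@lebesgue_measure R).

Lemma integrable_normal_pdfM m sigma g c : measurable_fun setT g ->
  (forall x, `|g x| <= c) ->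
  mu.-integrable setT (EFin \o (fun x => normal_pdf m sigma x * g x)).
Proof.
move=> mg gc.
apply: (@le_integrable _ _ _ mu setT measurableT _
  (fun x => (c%:E * (normal_pdf m sigma x)%:E)%E)).
- apply/measurable_EFinP; apply: measurable_funM => //.
  exact: measurable_normal_pdf.
- move=> x _; rewrite /= lee_fin !normrM mulrC.
  have c0 : 0 <= c by apply: le_trans (gc x).
  by rewrite (ger0_norm c0) ler_wpM2r.
- by apply: integrableZl => //; exact: integrable_normal_pdf.
Qed.

Lemma Rintegral_normal_pdf m sigma : \int[mu]_x normal_pdf m sigma x = 1.
Proof. by rewrite /Rintegral integral_normal_pdf. Qed.

(** Comparison with [c] times the indicator of [[x, x + 1]], an interval of length 1. All lower
    bounds on report probabilities come from this. *)
Lemma Rintegral_ge_unit_itv f c x : mu.-integrable setT (EFin \o f) ->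
  (forall y, 0 <= f y) -> 0 <= c -> (forall y, x <= y <= x + 1 -> c <= f y) ->
  c <= \int[mu]_y f y.
Proof.
move=> intf f0 c0 cf.
have mI : measurable `[x, x + 1] by [].
have ci : mu.-integrable setT (EFin \o (fun y => c * \1_`[x, x + 1] y)).
  rewrite (_ : EFin \o _ = fun y => c%:E * (\1_`[x, x + 1] y)%:E)%E//.
  by apply: integrableZl => //; exact: integrable_indic_itv.
have -> : c = \int[mu]_y (c * \1_`[x, x + 1] y).
  rewrite /Rintegral; under eq_integral do rewrite EFinM.
  rewrite ge0_integralZl//.
  - rewrite integral_indic// setIT [X in (_ * X)%E](_ : _ = 1%E) ?mule1//.
    apply: etrans (lebesgue_measure_itv `[x, x + 1]) _ => /=.
    by rewrite lte_fin ltrDl ltr01 -EFinB [x + 1]addrC addrK.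
  - exact/measurable_EFinP/measurable_indic.
apply: le_Rintegral => // y _; rewrite indicE; case: (boolP (y \in _)) => [|_].
  by rewrite inE/= in_itv/= mulr1 => /cf.
by rewrite mulr0.
Qed.

(** On this interval the distance to [m] is at most [A], and the witness is the value of the density
    at distance [A]. *)
Lemma normal_pdf_ge_itv m sigma x : 0 < sigma ->
  exists2 c, 0 < c & forall y, x <= y <= x + 1 -> c <= normal_pdf m sigma y.
Proof.
move=> s0; have s0' : sigma != 0 by rewrite gt_eqF.
pose A := `|x| + 1 + `|m|.
exists (normal_peak sigma * expR (- (A ^+ 2) / (sigma ^+ 2 *+ 2))).
  by rewrite mulr_gt0 ?expR_gt0// normal_peak_gt0.
move=> y /andP[xy yx]; rewrite normal_pdfE// /normal_fun ler_wpM2l ?normal_peak_ge0//.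
rewrite ler_expR ler_wpM2r ?invr_ge0 ?mulrn_wge0 ?sqr_ge0// lerN2.
rewrite -real_normK ?num_real// lerXn2r ?nnegrE// ?addr_ge0//.
rewrite (le_trans (ler_normB _ _))// lerD2r.
have -> : y = x + (y - x) by rewrite addrC subrK.
rewrite (le_trans (ler_normD _ _))// lerD2l ger0_norm ?subr_ge0//.
by rewrite lerBlDl.
Qed.

(** Completing the square: exponential tilting shifts the mean by [a * sigma ^+ 2]. Integrated, this
    gives the Gaussian moment generating function. *)
Lemma normal_pdf_tilt m sigma a x : 0 < sigma ->
  normal_pdf m sigma x * expR (a * x) =
  expR (a * m + a ^+ 2 * sigma ^+ 2 / 2) * normal_pdf (m + a * sigma ^+ 2) sigma x.
Proof.
move=> s0; have s0' : sigma != 0 by rewrite gt_eqF.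
rewrite !normal_pdfE// /normal_fun -[LHS]mulrA [RHS]mulrCA; congr (_ * _).
by rewrite -!expRD; congr expR; field.
Qed.

End gaussian_integrals.

(** * Bounds on the report probabilities *)

Section report_probability.
Context {R : realType}.
Variables eps sigma : R.
Hypotheses (eps0 : 0 < eps) (sigma0 : 0 < sigma).
Implicit Types l s m theta : R.
Local Notation mu := (@lebesgue_measure R).
Local Notation thr := (thr sigma).
Local Notation flipp := (flipp eps sigma).
Local Notation rplus := (report_plus_given eps sigma).
Local Notation pplus := (pplus eps sigma).
Local Notation kappa := (eps * sigma ^+ 2 / 2).

Lemma flipp_gt0 l s : 0 < flipp l s.
Proof. by rewrite divr_gt0 ?expR_gt0. Qed.

Lemma flipp_le_half l s : flipp l s <= 1 / 2.
Proof.
rewrite ler_wpM2r ?invr_ge0// -[leRHS]expR0 ler_expR oppr_le0.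
by rewrite mulr_ge0// ltW.
Qed.

Lemma expR_thr l : expR (eps * thr l) = expR (- (kappa * l)).
Proof. by congr expR; rewrite /Defs.thr; field. Qed.

Lemma rplus_below l s : s <= thr l -> rplus l s = expR (eps * (s - thr l)) / 2.
Proof.
move=> st; rewrite /report_plus_given ltNge st/= /Defs.flipp distrC.
by rewrite ger0_norm ?subr_ge0// -mulrN opprB.
Qed.

(** At [s = thr l] the definition takes the other branch, but both formulas equal 1/2 there, so the
    closed half-line is allowed. *)
Lemma rplus_above l s : thr l <= s ->
  rplus l s = 1 - expR (- (eps * (s - thr l))) / 2.
Proof.
rewrite le_eqVlt => /orP[/eqP<-|st].
  by rewrite rplus_below// subrr mulr0 oppr0 expR0; field.
rewrite /report_plus_given st /Defs.flipp ger0_norm// subr_ge0 ltW//.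
Qed.

Lemma rplus_gt0 l s : 0 < rplus l s.
Proof.
rewrite /report_plus_given; have := flipp_gt0 l s; have := flipp_le_half l s.
by case: ifP => _; lra.
Qed.

Lemma rplus_lt1 l s : rplus l s < 1.
Proof.
rewrite /report_plus_given; have := flipp_gt0 l s; have := flipp_le_half l s.
by case: ifP => _; lra.
Qed.

Lemma measurable_flipp l : measurable_fun setT (flipp l).
Proof.
apply: measurable_funM => //; apply: measurableT_comp => //.
apply: measurableT_comp => //; apply: measurable_funM => //.
by apply: measurableT_comp => //; exact: measurable_funB.
Qed.

Lemma measurable_rplus l : measurable_fun setT (rplus l).
Proof.
apply: measurable_fun_if => //.
- by apply: measurable_fun_ltr.
- by apply: measurable_funTS; apply: measurable_funB => //; exact: measurable_flipp.
- by apply: measurable_funTS; exact: measurable_flipp.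
Qed.

(** Below the threshold only the factor 1/2 is dropped; above it the exponential is at least 1. A
    single exponential can be integrated in closed form. *)
Lemma rplus_le_expR l s : rplus l s <= expR (eps * (s - thr l)).
Proof.
have [st|/ltW st] := leP s (thr l).
  by rewrite rplus_below// ler_pdivrMr// ler_peMr ?expR_ge0// ler1n.
rewrite (le_trans (ltW (rplus_lt1 _ _)))// -expR0 ler_expR.
by rewrite mulr_ge0 ?subr_ge0// ltW.
Qed.

Lemma onem_rplus_le_expR l s : 1 - rplus l s <= expR (- (eps * (s - thr l))).
Proof.
have [st|/ltW st] := leP (thr l) s.
  rewrite rplus_above// opprB addrCA subrr addr0.
  by rewrite ler_pdivrMr// ler_peMr ?expR_ge0// ler1n.
rewrite (@le_trans _ _ 1)//; first by have := rplus_gt0 l s; lra.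
rewrite -expR0 ler_expR oppr_ge0 mulr_ge0_le0//; first exact: ltW.
by rewrite subr_le0.
Qed.

Lemma rplus_nondecreasing l : {homo rplus l : s1 s2 / s1 <= s2}.
Proof.
move=> s1 s2 s12; have [t1|/ltW t1] := leP (thr l) s1.
  rewrite !rplus_above// ?(le_trans t1)// lerD2l lerN2 ler_wpM2r// ler_expR.
  by rewrite lerN2 ler_pM2l// lerB.
have [t2|/ltW t2] := leP s2 (thr l).
  by rewrite !rplus_below// ler_wpM2r// ler_expR ler_pM2l// lerB.
rewrite rplus_below// rplus_above//.
have : expR (eps * (s1 - thr l)) <= 1.
  by rewrite -expR0 ler_expR pmulr_rle0// subr_le0.
have : expR (- (eps * (s2 - thr l))) <= 1.
  by rewrite -expR0 ler_expR oppr_le0 pmulr_rge0// subr_ge0.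
lra.
Qed.

Lemma integrable_pdf_rplus theta l :
  mu.-integrable setT (EFin \o (fun s => normal_pdf theta sigma s * rplus l s)).
Proof.
apply: (integrable_normal_pdfM _ _ (measurable_rplus l) (c := 1)) => s.
by rewrite ger0_norm ltW// (rplus_gt0, rplus_lt1).
Qed.

Lemma integrable_pdf_onem_rplus theta l :
  mu.-integrable setT
    (EFin \o (fun s => normal_pdf theta sigma s * (1 - rplus l s))).
Proof.
apply: (@integrable_normal_pdfM _ _ _ _ 1).
  by apply: measurable_funB => //; exact: measurable_rplus.
move=> s; have := rplus_gt0 l s; have := rplus_lt1 l s => p1 p0.
by rewrite ger0_norm; lra.
Qed.

Lemma onem_pplusE theta l :
  1 - pplus theta l = \int[mu]_s (normal_pdf theta sigma s * (1 - rplus l s)).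
Proof.
rewrite -{1}(Rintegral_normal_pdf theta sigma) -RintegralB//.
- by apply: eq_Rintegral => s _; rewrite mulrBr mulr1.
- exact: integrable_normal_pdf.
- exact: integrable_pdf_rplus.
Qed.

Lemma Rintegral_pdf_expR theta a :
  \int[mu]_s (normal_pdf theta sigma s * expR (a * s)) =
  expR (a * theta + a ^+ 2 * sigma ^+ 2 / 2).
Proof.
under eq_Rintegral do rewrite normal_pdf_tilt//.
rewrite RintegralZl//; last exact: integrable_normal_pdf.
by rewrite Rintegral_normal_pdf mulr1.
Qed.

Lemma integrable_pdf_expR theta a : mu.-integrable setT
  (EFin \o (fun s => normal_pdf theta sigma s * expR (a * s))).
Proof.
rewrite (_ : _ \o _ = fun s =>
    ((expR (a * theta + a ^+ 2 * sigma ^+ 2 / 2))%:E *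
     (normal_pdf (theta + a * sigma ^+ 2) sigma s)%:E)%E); last first.
  by apply/funext => s /=; rewrite normal_pdf_tilt// EFinM.
by apply: integrableZl => //; exact: integrable_normal_pdf.
Qed.

(** The exponential majorant is integrated against the density; the constant is the moment
    generating function at [eps]. The bound is informative for very negative [l]. *)
Lemma pplus_le_expR theta : exists2 b, 0 < b &
  forall l, pplus theta l <= b * expR (kappa * l).
Proof.
exists (expR (eps * theta + eps ^+ 2 * sigma ^+ 2 / 2)); first exact: expR_gt0.
move=> l; rewrite -Rintegral_pdf_expR -RintegralZr//; last exact: integrable_pdf_expR.
have -> : expR (kappa * l) = expR (- (eps * thr l)).
  by rewrite expRN expR_thr expRN invrK.
apply: le_Rintegral => //; first exact: integrable_pdf_rplus.
- rewrite (_ : _ \o _ = fun s => ((normal_pdf theta sigma s * expR (eps * s))%:E *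
     (expR (- (eps * thr l)))%:E)%E)//.
  by apply: integrableZr => //; exact: integrable_pdf_expR.
- move=> s _; rewrite -mulrA -expRD -mulrN -mulrDr ler_wpM2l ?normal_pdf_ge0//.
  exact: rplus_le_expR.
Qed.

Lemma onem_pplus_le_expR theta : exists2 b, 0 < b &
  forall l, 1 - pplus theta l <= b * expR (- (kappa * l)).
Proof.
exists (expR (- eps * theta + (- eps) ^+ 2 * sigma ^+ 2 / 2)); first exact: expR_gt0.
move=> l; rewrite onem_pplusE -Rintegral_pdf_expR -RintegralZr//; last first.
  exact: integrable_pdf_expR.
rewrite -expR_thr; apply: le_Rintegral => //; first exact: integrable_pdf_onem_rplus.
- rewrite (_ : _ \o _ = fun s => ((normal_pdf theta sigma s * expR (- eps * s))%:E *
     (expR (eps * thr l))%:E)%E)//.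
  by apply: integrableZr => //; exact: integrable_pdf_expR.
- move=> s _; rewrite -mulrA -expRD ler_wpM2l ?normal_pdf_ge0//.
  have -> : - eps * s + eps * thr l = - (eps * (s - thr l)) by ring.
  exact: onem_rplus_le_expR.
Qed.

(** For [l <= l0] the threshold is at least [thr l0], so on the unit interval ending at [thr l0] the
    lower branch of the response applies for all these [l] at once. *)
Lemma pplus_ge_expR theta l0 : exists2 c, 0 < c &
  forall l, l <= l0 -> c * expR (kappa * l) <= pplus theta l.
Proof.
have [m m0 mP] := normal_pdf_ge_itv theta (thr l0 - 1) sigma0.
exists (m * (expR (eps * (thr l0 - 1)) / 2)).
  by rewrite mulr_gt0// divr_gt0// expR_gt0.
move=> l ll0; have tl : thr l0 <= thr l.
  by rewrite lerN2 ler_wpM2r ?invr_ge0// ler_wpM2l// sqr_ge0.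
have -> : expR (kappa * l) = expR (- (eps * thr l)).
  by rewrite expRN expR_thr expRN invrK.
apply: (Rintegral_ge_unit_itv (x := thr l0 - 1)).
- exact: integrable_pdf_rplus.
- by move=> s; rewrite mulr_ge0 ?normal_pdf_ge0// ltW// rplus_gt0.
- by rewrite mulr_ge0 ?expR_ge0// mulr_ge0 ?divr_ge0 ?expR_ge0// ltW.
- move=> s sI; have /andP[s1 s2] := sI; rewrite -mulrA ler_pM ?mP//.
  + exact: ltW.
  + rewrite rplus_below; last by rewrite (le_trans s2)// subrK.
    rewrite mulrAC -expRD ler_wpM2r ?invr_ge0// ler_expR -mulrBr.
    by rewrite ler_pM2l// lerB.
Qed.

(** Mirror image of [pplus_ge_expR], on the unit interval starting at [thr l0]. *)
Lemma onem_pplus_ge_expR theta l0 : exists2 c, 0 < c &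
  forall l, l0 <= l -> c * expR (- (kappa * l)) <= 1 - pplus theta l.
Proof.
have [m m0 mP] := normal_pdf_ge_itv theta (thr l0) sigma0.
exists (m * (expR (- (eps * (thr l0 + 1))) / 2)).
  by rewrite mulr_gt0// divr_gt0// expR_gt0.
move=> l ll0; have tl : thr l <= thr l0.
  by rewrite lerN2 ler_wpM2r ?invr_ge0// ler_wpM2l// sqr_ge0.
rewrite -expR_thr onem_pplusE.
apply: (Rintegral_ge_unit_itv (x := thr l0)).
- exact: integrable_pdf_onem_rplus.
- by move=> s; rewrite mulr_ge0 ?normal_pdf_ge0// subr_ge0 ltW// rplus_lt1.
- by rewrite mulr_ge0 ?expR_ge0// mulr_ge0 ?divr_ge0 ?expR_ge0// ltW.
- move=> s sI; have /andP[s1 s2] := sI; rewrite -mulrA ler_pM ?mP//.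
  + exact: ltW.
  + rewrite rplus_above ?(le_trans tl)// opprB addrCA subrr addr0.
    rewrite mulrAC -expRD ler_wpM2r ?invr_ge0// ler_expR.
    have -> : - (eps * (thr l0 + 1)) + eps * thr l = - (eps * (thr l0 + 1 - thr l)).
      by ring.
    by rewrite lerN2 ler_pM2l// lerB.
Qed.

Lemma pplus_gt0 theta l : 0 < pplus theta l.
Proof.
have [c c0 cP] := pplus_ge_expR theta l.
by rewrite (lt_le_trans _ (cP l _))// mulr_gt0// expR_gt0.
Qed.

Lemma pplus_lt1 theta l : pplus theta l < 1.
Proof.
have [c c0 cP] := onem_pplus_ge_expR theta l.
by rewrite -subr_gt0 (lt_le_trans _ (cP l _))// mulr_gt0// expR_gt0.
Qed.

(** The likelihood ratio of a signal: it is increasing in [s] and equals 1 at [s = 0]. *)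
Lemma normal_pdf_shift s :
  normal_pdf 1 sigma s = normal_pdf (-1) sigma s * expR (2 / sigma ^+ 2 * s).
Proof.
have s0 : sigma != 0 by rewrite gt_eqF.
rewrite normal_pdf_tilt// [X in expR X](_ : _ = 0) ?expR0 ?mul1r; last by field.
by congr (normal_pdf _ sigma s); field.
Qed.

Let g l s := rplus l s - rplus l 0.

Let integrable_pdf_g theta l :
  mu.-integrable setT (EFin \o (fun s => normal_pdf theta sigma s * g l s)).
Proof.
apply: (@integrable_normal_pdfM _ _ _ _ 1).
  by apply: measurable_funB => //; exact: measurable_rplus.
move=> s; rewrite /g ler_norml.
have := rplus_gt0 l s; have := rplus_lt1 l s.
by have := rplus_gt0 l 0; have := rplus_lt1 l 0; lra.
Qed.

Let pplus_diffE l : pplus 1 l - pplus (-1) l =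
  \int[mu]_s (normal_pdf 1 sigma s * g l s - normal_pdf (-1) sigma s * g l s).
Proof.
have E theta : \int[mu]_s (normal_pdf theta sigma s * g l s) =
    pplus theta l - rplus l 0.
  under eq_Rintegral do rewrite mulrBr.
  rewrite RintegralB//; [|exact: integrable_pdf_rplus|].
    rewrite RintegralZr//; last exact: integrable_normal_pdf.
    by rewrite Rintegral_normal_pdf mul1r.
  by apply: (@integrable_normal_pdfM _ _ _ _ `|rplus l 0|).
by rewrite RintegralB ?E; [lra| | |].
Qed.

(* [normal_pdf 1 - normal_pdf (-1)] has integral 0 and the sign of its argument,
   so subtracting the constant [rplus l 0] from the nondecreasing [rplus l]
   makes the integrand nonnegative; it is then bounded below on a unit interval. *)
Lemma pplus_diff_ge_expR l0 : exists2 a, 0 < a &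
  forall l, l0 <= l -> a * expR (- (kappa * l)) <= pplus 1 l - pplus (-1) l.
Proof.
(* [t0] is nonnegative and above every threshold with [l0 <= l]. On [[t0 + 1, t0 + 2]] the
   likelihood ratio exceeds 1 by at least [A], and the response exceeds its value at [t0] by at
   least [B * expR (- (kappa * l))]. *)
pose t0 := Num.max 0 (thr l0).
have t00 : 0 <= t0 by rewrite le_max lexx.
have [m m0 mP] := normal_pdf_ge_itv (-1) (t0 + 1) sigma0.
have sig2 : 0 < 2 / sigma ^+ 2 by rewrite divr_gt0// exprn_gt0.
pose A := expR (2 / sigma ^+ 2) - 1.
have A0 : 0 < A by rewrite subr_gt0 expR_gt1.
pose B := expR (- (eps * t0)) * ((1 - expR (- eps)) / 2).
have B0 : 0 < B.
  by rewrite mulr_gt0 ?expR_gt0// divr_gt0// subr_gt0 expR_lt1 oppr_lt0.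
exists (m * A * B); first by rewrite mulr_gt0// mulr_gt0//.
move=> l ll0; have tl : thr l <= t0.
  rewrite le_max; apply/orP; right.
  by rewrite lerN2 ler_wpM2r ?invr_ge0// ler_wpM2l// sqr_ge0.
rewrite pplus_diffE; apply: (Rintegral_ge_unit_itv (x := t0 + 1)).
- rewrite (_ : _ \o _ = fun s => ((normal_pdf 1 sigma s * g l s)%:E -
    (normal_pdf (-1) sigma s * g l s)%:E)%E)//.
  by apply: integrableB => //; exact: integrable_pdf_g.
- move=> s; rewrite -mulrBl normal_pdf_shift -[X in _ - X]mulr1 -mulrBr -mulrA.
  rewrite mulr_ge0 ?normal_pdf_ge0//.
  have [s0|/ltW s0] := leP 0 s.
    apply: mulr_ge0; rewrite subr_ge0; last exact: rplus_nondecreasing.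
    by rewrite -[leLHS]expR0 ler_expR mulr_ge0// ltW.
  apply: mulr_le0; rewrite subr_le0; last exact: rplus_nondecreasing.
  by rewrite -[leRHS]expR0 ler_expR mulr_ge0_le0// ltW.
- by rewrite mulr_ge0 ?expR_ge0// ltW// mulr_gt0// mulr_gt0//.
- move=> s sI; have /andP[s1 s2] := sI.
  have A_le : A <= expR (2 / sigma ^+ 2 * s) - 1.
    by rewrite lerB// ler_expR ler_peMr ?(ltW sig2)//; lra.
  have B_le : B * expR (- (kappa * l)) <= g l s.
    rewrite (@le_trans _ _ (rplus l s - rplus l t0)) ?lerB ?rplus_nondecreasing//.
    rewrite -expR_thr !rplus_above//; last by lra.
    have E1 : expR (- (eps * (t0 - thr l))) = expR (- (eps * t0)) * expR (eps * thr l).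
      by rewrite -expRD; congr expR; ring.
    have E2 : expR (- (eps * (s - thr l))) <= expR (- (eps * (t0 - thr l))) * expR (- eps).
      rewrite -expRD ler_expR -lerN2 !(opprK, opprD) -{2}[eps]mulr1 -mulrDr.
      by rewrite ler_pM2l//; lra.
    move: E2; rewrite E1 /B.
    set u := expR (- (eps * t0)); set v := expR (eps * thr l); set w := expR (- eps).
    by lra.
  rewrite -mulrBl normal_pdf_shift -[X in _ - X]mulr1 -mulrBr.
  rewrite -[leRHS]mulrA -[leLHS]mulrA -[leLHS]mulrA.
  rewrite ler_pM ?mP//; first exact: ltW.
    exact: mulr_ge0 (ltW A0) (mulr_ge0 (ltW B0) (expR_ge0 _)).
  exact: (ler_pM (ltW A0) (mulr_ge0 (ltW B0) (expR_ge0 _))).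
Qed.

End report_probability.

(** * Increments of the log-likelihood ratio *)

Section real_inequalities.
Context {R : realType}.
Implicit Types x p q l : R.

Lemma expR_le1D_expRM x : expR x <= 1 + x * expR x.
Proof.
have := expR_ge1Dx (- x); rewrite expRN -(ler_pM2r (expR_gt0 x)).
by rewrite mulVf ?gt_eqF ?expR_gt0//; lra.
Qed.

(** For [q <= 1 / 2], [1 / (1 - q) <= 1 + 2 * q <= expR (2 * q)]. Applied to a report of +1, with
    [q] the probability of -1 in the state -1. *)
Lemma ln_div_onem_le p q : 0 < p <= 1 -> 0 < q <= 1 / 2 ->
  ln (p / (1 - q)) <= 2 * q.
Proof.
move=> /andP[p0 p1] /andP[q0 q1]; have q'0 : 0 < 1 - q by lra.
rewrite -ler_expR lnK ?posrE ?divr_gt0// (le_trans _ (expR_ge1Dx _))//.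
by rewrite ler_pdivrMr//; nra.
Qed.

Lemma expR_half_ln x : 0 < x -> expR (ln x / 2) = Num.sqrt x.
Proof.
by move=> x0; rewrite -powR12_sqrt ?ltW// /powR gt_eqF// mulrC.
Qed.

(** Halving the log-likelihood ratio turns the weight [p] into the geometric mean of [p] and [q];
    summed over the reports this is the Hellinger affinity. *)
Lemma mul_expR_half_ln p q l : 0 < p -> 0 < q ->
  p * expR (- ((l + ln (p / q)) / 2)) =
  expR (- (l / 2)) * (Num.sqrt p * Num.sqrt q).
Proof.
move=> p0 q0; rewrite -!expR_half_ln// -{1}[p]lnK ?posrE// ln_div ?posrE//.
by rewrite -!expRD; congr expR; field.
Qed.

(* The left-hand side is one minus the squared Hellinger distance of the two
   Bernoulli distributions. *)
Lemma bernoulli_hellinger_le p q p' q' a b m :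
  0 < p -> 0 < q -> 0 < p' -> 0 < q' -> p + q = 1 -> p' + q' = 1 ->
  0 < a -> 0 < b -> 0 < m -> a * m <= q' - q -> q' <= b * m ->
  Num.sqrt p * Num.sqrt p' + Num.sqrt q * Num.sqrt q' <=
  1 - a ^+ 2 / (8 * b) * m.
Proof.
move=> p0 q0 p'0 q'0 + + a0 b0 m0.
rewrite -(sqr_sqrtr (ltW p0)) -(sqr_sqrtr (ltW q0)).
rewrite -(sqr_sqrtr (ltW p'0)) -(sqr_sqrtr (ltW q'0)).
rewrite !sqrtr_sqr !ger0_norm ?sqrtr_ge0//.
move: (sqrtr_ge0 p) (sqrtr_ge0 q) (sqrtr_ge0 p') (sqrtr_ge0 q').
move: (Num.sqrt p) (Num.sqrt q) (Num.sqrt p') (Num.sqrt q') => {p0 q0 p'0 q'0} {p q p' q'}.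
move=> x y x' y' x0 y0 x'0 y'0 xy x'y' ha hb.
(* The variables are now the square roots. The gap [y' ^+ 2 - y ^+ 2] is at most
   [2 * y' * (y' - y)], and squaring brings in [y' ^+ 2 <= b * m]. *)
have h1 : (a * m) ^+ 2 <= (y' - y) ^+ 2 * (4 * (b * m)).
  have h2 : a * m <= (y' - y) * (2 * y') by have := sqr_ge0 (y' - y); lra.
  have am0 : 0 <= a * m by rewrite mulr_ge0// ltW.
  have h3 : (a * m) ^+ 2 <= ((y' - y) * (2 * y')) ^+ 2.
    by rewrite lerXn2r ?nnegrE ?(le_trans _ h2).
  by rewrite (le_trans h3)// exprMn ler_wpM2l ?sqr_ge0// exprMn; lra.
have h2 : a ^+ 2 / (8 * b) * m <= (y' - y) ^+ 2 / 2.
  by rewrite mulrAC ler_pdivrMr ?mulr_gt0// -(ler_pM2r m0); lra.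
(* By the two normalisations the affinity is 1 minus half the sum of the squares of [x - x'] and
   [y - y']; the first square is discarded. *)
by have := sqr_ge0 (x - x'); lra.
Qed.

End real_inequalities.

(** * Upward growth and Hellinger drift of the log-likelihood ratio *)

Section llr_increments.
Context {R : realType}.
Variables eps sigma : R.
Hypotheses (eps0 : 0 < eps) (sigma0 : 0 < sigma).
Implicit Types (l : R) (b : bool).
Local Notation pact := (pact eps sigma).
Local Notation incr := (llr_incr eps sigma).
Local Notation kappa := (eps * sigma ^+ 2 / 2).

Let kappa0 : 0 < kappa.
Proof. by rewrite divr_gt0// mulr_gt0// exprn_gt0. Qed.

Lemma pact_gt0 b theta l : 0 < pact b theta l.
Proof. by case: b; rewrite /= ?subr_gt0 ?pplus_gt0 ?pplus_lt1. Qed.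

Lemma pact_sum theta l : pact true theta l + pact false theta l = 1.
Proof. by rewrite /= addrC subrK. Qed.

Lemma expR_incr b l : expR (incr l b) = pact b 1 l / pact b (-1) l.
Proof. by rewrite lnK// posrE divr_gt0// pact_gt0. Qed.

(** Under the state +1 the inverse likelihood ratio is a martingale: the weights of the state +1
    cancel, leaving the report law of the state -1, which sums to 1. *)
Lemma pact_expRN_incr l :
  \sum_(b <- [:: true; false]) pact b 1 l * expR (- (l + incr l b)) = expR (- l).
Proof.
have E b : pact b 1 l * expR (- (l + incr l b)) = expR (- l) * pact b (-1) l.
  rewrite opprD expRD [expR (- incr _ _)]expRN expR_incr invf_div mulrCA.
  by rewrite [_ * (_ / _)]mulrC divfK// gt_eqF// pact_gt0.
by rewrite !big_cons big_nil addr0 !E -mulrDr pact_sum mulr1.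
Qed.

Lemma pact_false_diff l : pact false (-1) l - pact false 1 l =
  pplus eps sigma 1 l - pplus eps sigma (-1) l.
Proof.
by rewrite /=; move: (pplus eps sigma 1 l) (pplus eps sigma (-1) l) => p p'; ring.
Qed.

(** Only the sign of the difference matters, so the comparison with [l0 = l] covers every [l]. *)
Lemma pact_false_le l : pact false 1 l <= pact false (-1) l.
Proof.
have [a a0 /(_ l (lexx _))] := pplus_diff_ge_expR eps0 sigma0 l.
rewrite -pact_false_diff -[_ <= pact _ _ _]subr_ge0; apply: le_trans.
by rewrite mulr_ge0 ?expR_ge0// ltW.
Qed.

Lemma incr_false_le0 l : incr l false <= 0.
Proof.
by rewrite ln_le0// ler_pdivrMr ?pact_gt0// mul1r pact_false_le.
Qed.

(* For large [l] the ratio of the probabilities of [+1] is [1 + O(expR (- kappa l))];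
   for small [l] both probabilities are of order [expR (kappa l)]. *)
Lemma expR_llr_step : exists2 K, 0 < K &
  forall l b, expR (kappa * (l + incr l b)) <= expR (kappa * l) + K.
Proof.
have [bq bq0 bqP] := onem_pplus_le_expR eps0 sigma0 (-1).
have [bp bp0 bpP] := pplus_le_expR eps0 sigma0 1.
(* Chosen so that [bq * expR (- (kappa * L)) = 1 / 2], as [ln_div_onem_le] requires. Below, [K1]
   serves reports of +1 with [L <= l], and [K2] those with [l <= L], where the ratio of
   probabilities is at most [bp / c]. *)
pose L := ln (2 * bq) / kappa.
have [c c0 cP] := pplus_ge_expR eps0 sigma0 (-1) L.
pose K1 := 2 * kappa * bq * expR kappa.
pose K2 := expR (kappa * (L + ln (bp / c))).
have K10 : 0 < K1 by rewrite /K1 mulr_gt0 ?expR_gt0// mulr_gt0// mulr_gt0.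
have K20 : 0 < K2 by rewrite expR_gt0.
exists (K1 + K2); first by rewrite addr_gt0.
move=> l [|]; last first.
  rewrite (@le_trans _ _ (expR (kappa * l)))//; last by rewrite lerDl addr_ge0// ltW.
  by rewrite ler_expR ler_pM2l// gerDl incr_false_le0.
have p0 := pact_gt0 true 1 l; have p'0 := pact_gt0 true (-1) l.
have [Ll|/ltW lL] := leP L l; last first.
  rewrite (@le_trans _ _ K2)//; last by rewrite addrA lerDr addr_ge0 ?expR_ge0// ltW.
  rewrite ler_expR ler_pM2l// lerD// /llr_incr.
  move: p0 p'0 (bpP l) (cP l lL) => /=.
  move: (pplus eps sigma 1 l) (pplus eps sigma (-1) l) => p p'.
  move=> p0 p'0 {bpP cP}bpP cP.
  rewrite ler_ln ?posrE ?divr_gt0// ler_pdivrMr// (le_trans bpP)//.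
  have -> : bp * expR (kappa * l) = bp / c * (c * expR (kappa * l)).
    by field; rewrite gt_eqF.
  by rewrite ler_wpM2l// divr_ge0// ltW.
pose q' := pact false (-1) l.
have q'E : pact true (-1) l = 1 - q' by rewrite /q' /= subKr.
have q'le : q' <= bq * expR (- (kappa * l)) by exact: bqP.
have q'half : q' <= 1 / 2.
  rewrite (le_trans q'le)// (@le_trans _ _ (bq * expR (- (kappa * L))))//.
    by rewrite ler_wpM2l ?(ltW bq0)// ler_expR lerN2 ler_pM2l.
  rewrite /L mulrCA divff ?gt_eqF// mulr1 expRN lnK ?posrE ?mulr_gt0//.
  by rewrite invfM mulrCA divff ?gt_eqF// mulr1 mul1r.
have q'0 : 0 < q' by exact: pact_gt0.
have p1 : pact true 1 l <= 1 by rewrite ltW// pplus_lt1.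
have incr_le : incr l true <= 2 * q'.
  by rewrite /llr_incr q'E ln_div_onem_le ?p0 ?q'0.
move: (incr l true) (q') q'0 q'le q'half incr_le.
move=> i {q' q'E p1 p0 p'0 cP bpP bqP} q q0 qle qhalf i_le.
rewrite mulrDr expRD.
(* Since [2 * q <= 1], the exponential is linear in [q] up to the factor [expR kappa].
   Multiplication by [expR (kappa * l)] then makes the correction the additive constant [K1]. *)
have step : expR (kappa * i) <= 1 + K1 * expR (- (kappa * l)).
  apply: (@le_trans _ _ (expR (kappa * (2 * q)))).
    by rewrite ler_expR ler_pM2l.
  rewrite (le_trans (expR_le1D_expRM _))// lerD2l.
  have -> : K1 * expR (- (kappa * l)) =
      kappa * (2 * (bq * expR (- (kappa * l)))) * expR kappa by rewrite /K1; ring.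
  apply: ler_pM; rewrite ?expR_ge0//.
  - by rewrite !mulr_ge0// ltW.
  - by rewrite ler_pM2l// ler_pM2l.
  - by rewrite ler_expR ger_pMr//; lra.
rewrite (le_trans (ler_wpM2l (expR_ge0 _) step))// mulrDr mulr1 lerD2l.
by rewrite mulrCA expRN divff ?gt_eqF ?expR_gt0// mulr1 lerDl ltW.
Qed.

(** The probabilities of -1 in the two states differ by order [expR (- (kappa * l))] and are
    themselves at most of that order, so the squared Hellinger distance is at least of the same
    order. *)
Lemma hellinger_drift l0 : exists2 a, 0 < a & forall l, l0 <= l ->
  \sum_(b <- [:: true; false]) pact b 1 l * expR (- ((l + incr l b) / 2)) <=
  expR (- (l / 2)) * (1 - a * expR (- (kappa * l))).
Proof.
have [a a0 aP] := pplus_diff_ge_expR eps0 sigma0 l0.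
have [bq bq0 bqP] := onem_pplus_le_expR eps0 sigma0 (-1).
exists (a ^+ 2 / (8 * bq)).
  by rewrite divr_gt0 ?exprn_gt0// mulr_gt0.
move=> l ll0; rewrite !big_cons big_nil addr0 /llr_incr.
have := pact_gt0 true 1 l; have := pact_gt0 true (-1) l.
have := pact_gt0 false 1 l; have := pact_gt0 false (-1) l.
have := pact_sum 1 l; have := pact_sum (-1) l.
have : a * expR (- (kappa * l)) <= pact false (-1) l - pact false 1 l.
  by rewrite pact_false_diff; exact: aP.
have : pact false (-1) l <= bq * expR (- (kappa * l)) by exact: bqP.
move=> {aP bqP}.
move: (pact true 1 l) (pact true (-1) l) (pact false 1 l) (pact false (-1) l).
move=> p p' q q' hb ha p'q' pq q'0 q0 p'0 p0.
rewrite mul_expR_half_ln// mul_expR_half_ln// -mulrDr ler_pM2l ?expR_gt0//.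
apply: bernoulli_hellinger_le => //; exact: expR_gt0.
Qed.

End llr_increments.

(** * The supermartingale *)

Section potential.
Context {R : realType}.
Variables eps sigma : R.
Hypotheses (eps0 : 0 < eps) (sigma0 : 0 < sigma).
Implicit Types (l x : R) (n : nat).
Local Notation pact := (pact eps sigma).
Local Notation incr := (llr_incr eps sigma).
Local Notation kappa := (eps * sigma ^+ 2 / 2).
Local Notation beta := ((2 * kappa)^-1).

(** Since [beta * kappa = 1 / 2], the second summand is [expR (- (l / 2))] times a power of [n], the
    quantity controlled by [hellinger_drift]. *)
Definition potential (eta K : R) n l : R :=
  expR (- (eta * ln n%:R)) * (K + expR (beta * (ln n%:R - kappa * l))).

Lemma potential_ge0 eta K n l : 0 <= K -> 0 <= potential eta K n l.
Proof. by move=> K0; rewrite mulr_ge0 ?expR_ge0// addr_ge0// expR_ge0. Qed.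

Lemma ln_succ_sub n : (0 < n)%N ->
  0 < ln (n.+1%:R : R) - ln n%:R <= n%:R^-1.
Proof.
move=> n0; have n0R : 0 < n%:R :> R by rewrite ltr0n.
rewrite subr_gt0 ltr_ln ?posrE ?ltr0n// ltr_nat ltnS leqnn/=.
rewrite -ln_div ?posrE ?ltr0n// -[n.+1]addn1 natrD mulrDl divff ?gt_eqF//.
by rewrite mul1r le_ln1Dx// (lt_trans (ltrN10 _))// invr_gt0.
Qed.

(** One step in the abstract, with [N = ln n], [d] the increment of [ln n], and
    [z = ln n - kappa * l]. Either the decrease [a * y] beats the growth [g * d], or [z] is at most
    [ln (g / a)] and the growth is paid by the decay of the term in [K]. *)
Lemma potential_drift (beta' eta a : R) : 0 < beta' -> 0 < eta -> 0 < a ->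
  exists2 K, 0 < K & forall N d z, 0 < d -> d <= expR (- N) -> d <= 1 ->
  expR (- (eta * d)) *
    (K + expR (beta' * (z + d)) * (1 - a * expR (z - N))) <=
  K + expR (beta' * z).
Proof.
move=> b0 eta0 a0; set g := beta' * expR beta'.
have g0 : 0 < g by rewrite mulr_gt0// expR_gt0.
set Z0 := expR (beta' * ln (g / a)); have Z00 : 0 < Z0 by exact: expR_gt0.
exists (Z0 * g / eta); first by rewrite divr_gt0// mulr_gt0.
set K := _ / eta => N d z d0 dN d1.
have K0 : 0 < K by rewrite divr_gt0// mulr_gt0.
rewrite expRN mulrC ler_pdivrMr ?expR_gt0//.
set Z := expR (beta' * z); set y := expR (z - N).
have Z1 : 0 < Z by exact: expR_gt0.
have y0 : 0 < y by exact: expR_gt0.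
have eE : expR (beta' * d) <= 1 + g * d.
  rewrite (le_trans (expR_le1D_expRM _))// lerD2l /g mulrAC.
  by rewrite ler_wpM2r ?(ltW d0)// ler_wpM2l ?(ltW b0)// ler_expR ler_piMr// ltW.
have e1 : 1 <= expR (beta' * d) by rewrite -[leLHS]expR0 ler_expR mulr_ge0// ltW.
rewrite [beta' * (z + d)]mulrDr expRD -/Z.
have main : Z * (g * d - a * y) <= eta * d * K.
  have -> : eta * d * K = Z0 * (g * d) by rewrite /K; field; rewrite gt_eqF.
  have [ay|ay] := leP (g * d) (a * y).
    apply: (@le_trans _ _ 0); last by rewrite mulr_ge0 ?ltW// mulr_gt0.
    by rewrite mulr_ge0_le0 ?subr_le0// ltW.
  (* Here [a * y < g * d <= g * expR (- N)]; cancelling [expR (- N)] bounds [z]. *)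
  have ZZ0 : Z <= Z0.
    rewrite ler_expR ler_pM2l// -ler_expR lnK ?posrE ?divr_gt0//.
    rewrite ler_pdivlMr// -[z](subrK N) expRD -/y.
    rewrite mulrAC -ler_pdivlMr ?expR_gt0// -expRN mulrC (le_trans (ltW ay))//.
    by rewrite ler_wpM2l// ltW.
  apply: ler_pM => //; first exact: ltW.
    by rewrite subr_ge0 ltW.
  by rewrite gerBl mulr_ge0// ltW.
have ed : 1 + eta * d <= expR (eta * d) by exact: expR_ge1Dx.
apply: (@le_trans _ _ ((K + Z) * (1 + eta * d))); last first.
  by rewrite ler_wpM2l// addr_ge0// ltW.
set e := expR (beta' * d) in eE e1 *.
have : e * (1 - a * y) - 1 <= g * d - a * y.
  by have : 0 <= (e - 1) * (a * y); [rewrite mulr_ge0 ?subr_ge0 ?mulr_ge0// ltW|lra].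
rewrite -(ler_pM2l Z1) => /le_trans /(_ main) {}main.
have : 0 <= Z * (eta * d) by rewrite !mulr_ge0// ltW.
by lra.
Qed.

Lemma potential_supermartingale (l0 eta : R) : 0 < eta ->
  exists2 K, 0 < K & forall n l, (0 < n)%N -> l0 <= l ->
  \sum_(b <- [:: true; false]) pact b 1 l * potential eta K n.+1 (l + incr l b) <=
  potential eta K n l.
Proof.
move=> eta0.
have kappa0 : 0 < kappa by rewrite divr_gt0// mulr_gt0// exprn_gt0.
have beta0 : 0 < beta by rewrite invr_gt0 mulr_gt0.
have [a a0 aP] := hellinger_drift eps0 sigma0 l0.
have [K K0 KP] := potential_drift beta0 eta0 a0.
exists K => // n l n0 ll0; have /andP[d0 dn] := ln_succ_sub n0.
set N := ln n%:R in d0 dn; set d := _ - N in d0 dn.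
have n0R : 0 < n%:R :> R by rewrite ltr0n.
have := KP N d (N - kappa * l) d0; rewrite expRN lnK ?posrE// => /(_ dn).
have -> : N - kappa * l - N = - (kappa * l) by ring.
have d1 : d <= 1 by rewrite (le_trans dn)// invf_le1// ler1n.
have bE t : expR (beta * (t - kappa * l)) = expR (beta * t) * expR (- (l / 2)).
  by rewrite -expRD; congr expR; field; rewrite !gt_eqF.
move=> /(_ d1) main; rewrite /potential -/N.
have dE : ln n.+1%:R = N + d by rewrite /d addrC subrK.
have {}main : expR (- (eta * d)) * (K + expR (beta * (N + d)) *
    (expR (- (l / 2)) * (1 - a * expR (- (kappa * l))))) <=
    K + expR (beta * (N - kappa * l)).
  by move: main; rewrite addrAC bE -!mulrA.
rewrite !dE mulrDr opprD expRD -[leRHS]mulr1.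
have := aP l ll0; have := pact_sum eps sigma 1 l.
rewrite !big_cons !big_nil !addr0.
move: (pact_gt0 eps0 sigma0 true 1 l) (pact_gt0 eps0 sigma0 false 1 l).
move: (pact true 1 l) (pact false 1 l) => p q p0 q0 pq pqle.
have bE' i : expR (beta * (N + d - kappa * (l + i))) =
    expR (beta * (N + d)) * expR (- ((l + i) / 2)).
  by rewrite -expRD; congr expR; field; rewrite !gt_eqF.
rewrite !bE' mulr1.
rewrite (_ : _ + _ = expR (- (eta * N)) * (expR (- (eta * d)) * (K +
  expR (beta * (N + d)) * (p * expR (- ((l + incr l true) / 2)) +
  q * expR (- ((l + incr l false) / 2)))))); last first.
  by rewrite -[in RHS](mulr1 K) -pq; ring.
rewrite ler_pM2l ?expR_gt0//; apply: le_trans main.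
by rewrite ler_pM2l ?expR_gt0// lerD2l ler_pM2l ?expR_gt0.
Qed.

(* The first term keeps the public log-likelihood ratio above [- M], where the
   drift estimate behind the second term is available. *)
Lemma stopping_potential (r delta : R) : 0 < r -> 0 < delta ->
  exists (Phi : nat -> R -> R) (D : R),
  [/\ Phi 1 0 <= delta, (forall n l, 0 <= Phi n l),
  (forall n l, (0 < n)%N -> Phi n l < 1 ->
    \sum_(b <- [:: true; false]) pact b 1 l * Phi n.+1 (l + incr l b) <= Phi n l) &
  (forall n l, (0 < n)%N -> Phi n l < 1 ->
    ln n%:R - kappa * l <= D + r * ln n%:R)].
Proof.
(* [M] and, below, [x] are chosen so that each of the two terms starts at [delta / 2]. *)
move=> r0 delta0; pose M := ln (2 / delta).
have beta0 : 0 < beta.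
  by rewrite invr_gt0 mulr_gt0// divr_gt0// mulr_gt0// exprn_gt0.
(* With this rate, a potential of at most [x] gives [beta * z <= ln x + r * beta * ln n], and
   division by [beta] gives the claim. *)
set eta := r * beta; have eta0 : 0 < eta by rewrite mulr_gt0.
have [K K0 KP] := potential_supermartingale (- M) eta0.
have h0 : 0 < potential eta K 1 0.
  by rewrite mulr_gt0 ?expR_gt0// addr_gt0// expR_gt0.
set x := 2 * potential eta K 1 0 / delta.
have x0 : 0 < x by rewrite divr_gt0// mulr_gt0.
exists (fun n l => expR (- l) / expR M + potential eta K n l / x), (ln x / beta).
have pot0 n l : 0 <= potential eta K n l / x.
  by rewrite divr_ge0 ?potential_ge0// ltW.
split=> //.
- rewrite /M lnK ?posrE ?divr_gt0// oppr0 expR0 /x.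
  by rewrite le_eqVlt; apply/orP; left; apply/eqP; field; rewrite !gt_eqF.
- by move=> n l; rewrite addr_ge0// divr_ge0 ?expR_ge0.
- move=> n l n0 Phi1.
  have Ml : - M <= l.
    rewrite -lerN2 opprK -ler_expR -[leRHS]mul1r -ler_pdivrMr ?expR_gt0// ltW//.
    by rewrite (le_lt_trans _ Phi1)// lerDl.
  have := KP n l n0 Ml; rewrite -(ler_pM2r (_ : 0 < x^-1)) ?invr_gt0//.
  have := pact_expRN_incr eps0 sigma0 l => <-.
  rewrite !big_cons !big_nil !addr0.
  move: (pact true 1 l) (pact false 1 l) => p q.
  by rewrite -(lerD2l ((p * expR (- (l + incr l true)) +
    q * expR (- (l + incr l false))) / expR M)); apply: le_trans; lra.
- move=> n l n0 Phi1; have : potential eta K n l <= x.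
    rewrite -[leRHS]mul1r -ler_pdivrMr//; apply: le_trans (ltW Phi1).
    by rewrite lerDr divr_ge0 ?expR_ge0.
  rewrite /potential /eta; move: (beta) beta0 (ln n%:R) => b b0 L.
  rewrite expRN mulrC ler_pdivrMr ?expR_gt0// => h.
  have : expR (b * (L - kappa * l)) <= expR (ln x + r * b * L).
    by rewrite expRD lnK ?posrE//; apply: le_trans h; rewrite lerDr ltW.
  rewrite ler_expR => {}h; rewrite -(ler_pM2l b0) (le_trans h)//.
  by rewrite le_eqVlt; apply/orP; left; apply/eqP; field; rewrite gt_eqF.
Qed.

End potential.

(** * Independence of pairs *)

Section independent_pairs.
Context d (T : measurableType d) (R : realType) (P : probability T R).
Context d1 d2 (T1 : measurableType d1) (T2 : measurableType d2).

Lemma measurable_preimageI (A : set T) (Z : T -> T1 * T2) X :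
  measurable A -> measurable_fun setT Z -> measurable X ->
  measurable (A `&` Z @^-1` X).
Proof.
by move=> mA mZ mX; apply: measurableI => //; rewrite -[_ @^-1` _]setTI; exact: mZ.
Qed.

Let preimage_measure (A : set T) (Z : T -> T1 * T2) :
  measurable A -> measurable_fun setT Z ->
  exists m : {measure set (T1 * T2) -> \bar R}, forall X, m X = P (A `&` Z @^-1` X).
Proof.
move=> mA mZ; pose m X := P (A `&` Z @^-1` X).
have m0 : m set0 = 0%E by rewrite /m preimage_set0 setI0 measure0.
have mge0 X : (0 <= m X)%E by exact: measure_ge0.
have msa : semi_sigma_additive m.
  move=> F mF tF mUF; rewrite /m preimage_bigcup setI_bigcupr.
  apply: measure_semi_sigma_additive.
  - by move=> n; exact: measurable_preimageI.
  - apply: trivIset_setIl; apply/trivIsetP => /= i j _ _ ij.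
    rewrite -preimage_setI; move/trivIsetP : tF => /(_ _ _ _ _ ij) ->//.
  - by rewrite -setI_bigcupr -preimage_bigcup; exact: measurable_preimageI.
pose mm : {measure set (T1 * T2) -> \bar R} :=
  HB.pack m (isMeasure.Build _ _ _ m m0 mge0 msa).
by exists mm.
Qed.

(** Both sides are finite measures in [X]; they agree on rectangles, which are stable under
    intersection and generate the product sigma-algebra. *)
Lemma indep_of_rectangles (A : set T) (Z : T -> T1 * T2) :
  measurable A -> measurable_fun setT Z ->
  (forall E F, measurable E -> measurable F ->
    P (A `&` Z @^-1` (E `*` F)) = (P A * P (Z @^-1` (E `*` F)))%E) ->
  forall X, measurable X -> P (A `&` Z @^-1` X) = (P A * P (Z @^-1` X))%E.
Proof.
move=> mA mZ AZ.
have [m1 m1E] := preimage_measure mA mZ.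
have [m2 m2E] := preimage_measure (@measurableT _ T) mZ.
have PA : P A \is a fin_num by exact: fin_num_measure.
have PA0 : 0 <= fine (P A) by rewrite fine_ge0.
pose m3 := mscale (NngNum PA0) m2.
have m3E X : m3 X = (P A * P (Z @^-1` X))%E.
  by rewrite /m3 /mscale/= fineK// m2E setTI.
move=> X mX; rewrite -m1E -m3E.
pose C : set (set (T1 * T2)) :=
  [set C | exists A, measurable A /\ exists B, measurable B /\ C = A `*` B].
apply: (measure_unique C (fun=> setT)) => //.
- rewrite measurable_prod_measurableType //; congr (<<s _ >>).
  rewrite predeqE; split => [[E mE [F mF <-]]|[E [mE [F [mF ->]]]]].
    by exists E; split => //; exists F.
  by exists E => //; exists F.
- move=> /= _ _ [X1 [mX1 [X2 [mX2 ->]]]] [Y1 [mY1 [Y2 [mY2 ->]]]].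
  rewrite -setXI; exists (X1 `&` Y1); split; first exact: measurableI.
  by exists (X2 `&` Y2); split => //; exact: measurableI.
- by move=> _; exists setT; split => //; exists setT; split => //; rewrite setXTT.
- by rewrite bigcup_const//; exists 0%N.
- by move=> _ [E [mE [F [mF ->]]]]; rewrite m1E AZ//; exact/esym/m3E.
- move=> _; apply: (@le_lt_trans _ _ 1%E); last exact: ltry.
  by rewrite m1E; apply: probability_le1; exact: measurable_preimageI.
Qed.

Lemma product_law (m1 : {sigma_finite_measure set T1 -> \bar R})
    (m2 : {sigma_finite_measure set T2 -> \bar R}) (Z : T -> T1 * T2) :
  measurable_fun setT Z ->
  (forall E F, measurable E -> measurable F ->
    P (Z @^-1` (E `*` F)) = (m1 E * m2 F)%E) ->
  forall X, measurable X -> P (Z @^-1` X) = (m1 \x m2)%E X.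
Proof.
move=> mZ rect X mX; have [m mE] := preimage_measure (@measurableT _ T) mZ.
rewrite (product_measure_unique (m' := m))//; first by rewrite mE setTI.
by move=> E F mE' mF; rewrite mE setTI rect.
Qed.

(** * Sequences of independent pairs *)

Variable Z : nat -> T -> T1 * T2.
Hypothesis mZ : forall i, measurable_fun setT (Z i).

Definition cylinder (B : nat -> set (T1 * T2)) k : set T :=
  [set w | forall i, (i < k)%N -> B i (Z i w)].

Lemma cylinderS B k : cylinder B k.+1 = cylinder B k `&` Z k @^-1` B k.
Proof.
apply/seteqP; split => w /=.
  by move=> h; split => [i ik|]; apply: h => //; rewrite ltnW.
by move=> [h hk] i; rewrite ltnS leq_eqVlt => /orP[/eqP->//|]; exact: h.
Qed.

Lemma measurable_cylinder B k : (forall i, measurable (B i)) ->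
  measurable (cylinder B k).
Proof.
move=> mB; elim: k => [|k ih]; last by rewrite cylinderS; exact: measurable_preimageI.
by rewrite (_ : cylinder B 0 = setT)//; apply/seteqP; split.
Qed.

Hypothesis indep_rect : forall E F k,
  (forall i, measurable (E i)) -> (forall i, measurable (F i)) ->
  P (cylinder (fun i => E i `*` F i) k) =
  (\prod_(i < k) P (Z i @^-1` (E i `*` F i)))%E.

(* The rectangles are replaced by arbitrary measurable sets one index at a time. *)
Lemma cylinder_indep B k : (forall i, measurable (B i)) ->
  P (cylinder B k) = (\prod_(i < k) P (Z i @^-1` B i))%E.
Proof.
(* Induction on [m]: the sets with index below [m] are arbitrary, those from [m] on are rectangles.
   To start from [m = k], the sets beyond [k] are replaced by the full space. *)
suff H m : (m <= k)%N -> forall B, (forall i, measurable (B i)) ->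
    (forall i, (m <= i)%N -> exists E F, [/\ measurable E, measurable F & B i = E `*` F]) ->
    P (cylinder B k) = (\prod_(i < k) P (Z i @^-1` B i))%E.
  move=> mB; pose B' i := if (i < k)%N then B i else setT.
  have -> : cylinder B k = cylinder B' k.
    by apply/seteqP; split => w /= h i ik; have := h i ik; rewrite /B' ik.
  rewrite (H k)//.
  - by apply: eq_bigr => i _; rewrite /B' ltn_ord.
  - by move=> i; rewrite /B'; case: ifP.
  - move=> i ki; rewrite /B' ltnNge ki/=; exists setT, setT; split => //.
    by rewrite setXTT.
elim: m => [_|m ih mk] {}B mB rB.
  have rB' i := rB i (leq0n i).
  have /choice[E /choice[F EF]] : forall i, exists E, exists F,
    [/\ measurable E, measurable F & B i = E `*` F] by [].
  rewrite (_ : B = fun i => E i `*` F i); last first.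
    by apply/funext => i; have [_ _] := EF i.
  by apply: indep_rect => i; have [] := EF i.
(* With all other sets fixed, the formula is known for rectangles at index [m], and
   [indep_of_rectangles] extends it to [B m]. *)
pose B0 X i := if i == m then X else B i.
have mB0 X : measurable X -> forall i, measurable (B0 X i).
  by move=> mX i; rewrite /B0; case: ifP.
have B0E X : cylinder (B0 X) k = cylinder (B0 setT) k `&` Z m @^-1` X.
  apply/seteqP; split => w /=.
    move=> h; split => [i ik|]; last by have := h m mk; rewrite /B0 eqxx.
    by have := h i ik; rewrite /B0; case: eqP.
  by move=> [h hm] i ik; have := h i ik; rewrite /B0; case: eqP => [->|].
have prodE X : measurable X -> (\prod_(i < k) P (Z i @^-1` B0 X i) =
    \prod_(i < k) P (Z i @^-1` B0 setT i) * P (Z m @^-1` X))%E.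
  move=> mX; rewrite (bigD1 (Ordinal mk))//= [in RHS](bigD1 (Ordinal mk))//=.
  rewrite {1 3}/B0 eqxx preimage_setT probability_setT mul1e muleC; congr (_ * _)%E.
  by apply: eq_bigr => i /eqP im; rewrite /B0; case: eqP => // im'; case: im; exact: val_inj.
have rect E F : measurable E -> measurable F ->
    P (cylinder (B0 (E `*` F)) k) = (\prod_(i < k) P (Z i @^-1` B0 (E `*` F) i))%E.
  move=> mE mF; apply: ih; first exact: ltnW.
    by apply: mB0; exact: measurableX.
  move=> i; rewrite leq_eqVlt /B0 eq_sym; case: eqP => [_ _|_ /=]; last exact: rB.
  by exists E, F.
have BE : B = B0 (B m) by apply/funext => i; rewrite /B0; case: eqP => [->|].
have PT : P (cylinder (B0 setT) k) = (\prod_(i < k) P (Z i @^-1` B0 setT i))%E.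
  by have := @rect setT setT measurableT measurableT; rewrite setXTT.
rewrite BE B0E (@indep_of_rectangles _ (Z m))//.
- by rewrite (prodE (B m))// PT.
- by apply: measurable_cylinder; exact: mB0.
- move=> E F mE mF; rewrite -B0E rect// prodE ?PT//; exact: measurableX.
Qed.

Lemma cylinder_indep_next B k X : (forall i, measurable (B i)) -> measurable X ->
  P (cylinder B k `&` Z k @^-1` X) = (P (cylinder B k) * P (Z k @^-1` X))%E.
Proof.
move=> mB mX; pose B' i := if i == k then X else B i.
have mB' i : measurable (B' i) by rewrite /B'; case: ifP.
have B'k i : (i < k)%N -> B' i = B i by rewrite /B' ltn_neqAle => /andP[/negbTE->].
have BB' : cylinder B k = cylinder B' k.
  by apply/seteqP; split => w /= h i ik; have := h i ik; rewrite B'k.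
have B'X : B' k = X by rewrite /B' eqxx.
rewrite BB' -{1}B'X -cylinderS !cylinder_indep// big_ord_recr/= B'X; congr (_ * _)%E.
Qed.

End independent_pairs.

(** * Law of a report *)

Section normal_integral.
Context {R : realType}.
Local Notation mu := (@lebesgue_measure R).
Variables m sigma : R.

(** The Radon-Nikodym derivative is almost everywhere the density, as both integrate to the normal
    law over every measurable set. *)
Lemma integral_normal_prob (f : R -> \bar R) :
  measurable_fun setT f -> (forall x, 0 <= f x)%E ->
  (\int[normal_prob m sigma]_x f x = \int[mu]_x (f x * (normal_pdf m sigma x)%:E))%E.
Proof.
move=> mf f0; have nd := normal_prob_dominates m sigma.
rewrite -(Radon_Nikodym_SigmaFinite.change_of_variables nd f0 measurableT mf).
have ipdf := integrable_normal_pdf m sigma.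
have mpdf := measurable_int _ ipdf.
have irn := Radon_Nikodym_SigmaFinite.f_integrable nd.
have mrn := measurable_int _ irn.
apply: ae_eq_integral => //; [exact: emeasurable_funM|exact: emeasurable_funM|].
have : ae_eq mu setT (Radon_Nikodym_SigmaFinite.f (normal_prob m sigma) mu)
    (fun x => (normal_pdf m sigma x)%:E).
  apply: integral_ae_eq => // E _ mE.
  by rewrite -Radon_Nikodym_SigmaFinite.f_integral.
by apply: filterS => x /= /[apply] ->.
Qed.

End normal_integral.

Section report_law.
Context d (T : measurableType d) (R : realType) (P : probability T R).
Variables eps sigma : R.
Hypotheses (eps0 : 0 < eps) (sigma0 : 0 < sigma).
Local Notation mu := (@lebesgue_measure R).

Definition reports (l : R) (b : bool) : set (R * R) :=
  [set z | report eps sigma l z.1 z.2 = b].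

Lemma measurable_reports l b : measurable (reports l b).
Proof.
have mr : measurable_fun setT (fun z : R * R => report eps sigma l z.1 z.2).
  rewrite /report; apply: measurable_fun_if => //.
  - apply: measurable_fun_ltr => //.
    by apply: measurableT_comp => //; exact: measurable_flipp.
  - apply: measurable_funTS; apply: measurable_neg.
    exact: measurable_fun_ltr.
  - by apply: measurable_funTS; exact: measurable_fun_ltr.
by rewrite -[reports _ _]setTI; exact: (mr measurableT [set b]).
Qed.

Lemma uniform01E (B : set R) : measurable B ->
  uniform_prob (@ltr01 R) B = mu (B `&` `[0, 1]%classic).
Proof.
move=> mB; rewrite /uniform_prob integral_uniform_pdf.
rewrite (eq_integral (fun=> 1%E)); last first.
  move=> x; rewrite inE /= => -[_]; rewrite /= in_itv/= /uniform_pdf => ->.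
  by rewrite subr0 invr1.
by rewrite integral_cst ?mul1e//; exact: measurableI.
Qed.

(** For a fixed signal, the randomizations in [[0, 1]] that yield +1 form [[u, 1]] above the
    threshold and [[0, u[] otherwise. *)
Lemma uniform01_reports l s :
  uniform_prob (@ltr01 R) (xsection (reports l true) s) =
  (report_plus_given eps sigma l s)%:E.
Proof.
have u0 := flipp_gt0 eps sigma l s; have u1 := flipp_le_half sigma eps0 l s.
rewrite uniform01E; last by apply: measurable_xsection; exact: measurable_reports.
rewrite /report_plus_given; set u := flipp _ _ _ _ in u0 u1 *.
case: ifPn => st.
  rewrite (_ : _ `&` _ = `[u, 1]%classic); last first.
    apply/seteqP; split=> v; rewrite /xsection /reports /report/= !in_itv/= ?inE/= st -/u.
      by case: ltP => //= uv [] // _ /andP[].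
    move=> /andP[uv v1]; rewrite ltNge uv/=; split => //.
    by rewrite v1 andbT (le_trans _ uv)// ltW.
  apply: etrans (lebesgue_measure_itv `[u, 1]) _ => /=.
  by rewrite lte_fin ifT ?EFinB//; lra.
rewrite (_ : _ `&` _ = `[0, u[%classic); last first.
  apply/seteqP; split=> v; rewrite /xsection /reports /report/= !in_itv/= ?inE/= (negbTE st) -/u.
    by case: ltP => //= uv [] // _ /andP[->].
  move=> /andP[v0 vu]; rewrite vu/=; split => //.
  by rewrite v0 (le_trans (ltW vu))//; lra.
apply: etrans (lebesgue_measure_itv `[0, u[) _ => /=.
by rewrite lte_fin u0 sube0.
Qed.

Lemma normal_uniform_reports l :
  (normal_prob 1 sigma \x uniform_prob (@ltr01 R))%E (reports l true) =
  (pplus eps sigma 1 l)%:E.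
Proof.
rewrite /product_measure1; under eq_integral do rewrite /= uniform01_reports.
rewrite integral_normal_prob; last 2 first.
- by apply/measurable_EFinP; exact: measurable_rplus.
- by move=> x; rewrite lee_fin ltW// rplus_gt0.
rewrite /pplus /Rintegral fineK.
  by apply: eq_integral => x _; rewrite -EFinM mulrC.
by apply: integrable_fin_num => //; exact: integrable_pdf_rplus.
Qed.

Variables S V : {mfun T >-> R}.
Hypothesis lawS : forall B, measurable B -> P (S @^-1` B) = normal_prob 1 sigma B.
Hypothesis lawV : forall B, measurable B ->
  P (V @^-1` B) = lebesgue_measure (B `&` `[0, 1]%classic).
Hypothesis indepSV : forall E F, measurable E -> measurable F ->
  P (S @^-1` E `&` V @^-1` F) = (P (S @^-1` E) * P (V @^-1` F))%E.

Lemma report_law l b :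
  P ((fun w => (S w, V w)) @^-1` reports l b) = (pact eps sigma b 1 l)%:E.
Proof.
pose Z w := (S w, V w).
have mZ : measurable_fun setT Z by exact: measurable_fun_pair.
have true_law : P (Z @^-1` reports l true) = (pplus eps sigma 1 l)%:E.
  rewrite -normal_uniform_reports.
  apply: (product_law (m1 := normal_prob 1 sigma) (m2 := uniform_prob (@ltr01 R))) => //.
    by move=> E F mE mF; rewrite /= -lawS// uniform01E// -lawV// -indepSV.
  exact: measurable_reports.
case: b => //.
rewrite (_ : _ @^-1` _ = ~` (Z @^-1` reports l true)); last first.
  by apply/seteqP; split => w; rewrite /reports /=; case: report.
have mrep : measurable (Z @^-1` reports l true).
  by rewrite -[X in measurable X]setTI; apply: mZ => //; exact: measurable_reports.
by rewrite probability_setC// true_law.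
Qed.

End report_law.

(** * Histories and the maximal inequality *)

Section histories.
Context d (T : measurableType d) (R : realType) (P : probability T R).
Variables eps sigma : R.
Hypotheses (eps0 : 0 < eps) (sigma0 : 0 < sigma).
Local Notation incr := (llr_incr eps sigma).
Local Notation pact := (pact eps sigma).

(* Histories list the reported actions starting from the most recent one. *)
Definition llr (h : seq bool) : R := foldr (fun b l => l + incr l b) 0 h.

Fixpoint history (s v : nat -> R) n : seq bool :=
  if n is m.+1 then
    report eps sigma (llr (history s v m)) (s n) (v n) :: history s v m
  else [::].

(** The ratio seen by agent [n.+1] depends only on the first [n] reports, so probabilities can be
    computed by induction over finite histories. *)
Lemma lpub_history s v n : lpub eps sigma s v n.+1 = llr (history s v n).
Proof.
elim: n => [|n ih]; first by [].
rewrite [RHS](_ : _ = llr (history s v n) + incr (llr (history s v n))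
  (report eps sigma (llr (history s v n)) (s n.+1) (v n.+1))); last by [].
by rewrite -ih.
Qed.

Lemma size_history s v n : size (history s v n) = n.
Proof. by elim: n => //= n ->. Qed.

Variables s V : nat -> {mfun T >-> R}.
Hypothesis lawS : forall n B, measurable B -> P (s n @^-1` B) = normal_prob 1 sigma B.
Hypothesis lawV : forall n B, measurable B ->
  P (V n @^-1` B) = lebesgue_measure (B `&` `[0, 1]%classic).
Hypothesis indep : mutually_independent P
  (fun i : nat + nat => match i with inl n => (s n : T -> R) | inr n => (V n : T -> R) end).

Let X (i : nat + nat) : T -> R := match i with inl n => s n | inr n => V n end.

Lemma indep_seq (r : seq (nat + nat)) (B : nat + nat -> set R) :
  uniq r -> (forall i, measurable (B i)) ->
  P [set w | forall i, i \in r -> B i (X i w)] =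
  (\prod_(i <- r) P (X i @^-1` B i))%E.
Proof.
move=> ur mB; have := @indep [fset i in r]%fset B (fun i _ => mB i).
rewrite (perm_big r) /=; last first.
  apply: uniq_perm => //; first exact: fset_uniq.
  by move=> i; rewrite inE.
move=> <-; congr (P _); apply/seteqP; split => w /= h i.
  by move=> /= ir; apply: h; rewrite inE in ir.
by move=> ir; apply: h => /=; rewrite inE.
Qed.

Lemma indep_pair n E F : measurable E -> measurable F ->
  P (s n @^-1` E `&` V n @^-1` F) = (P (s n @^-1` E) * P (V n @^-1` F))%E.
Proof.
move=> mE mF; pose B (i : nat + nat) := if i is inl _ then E else F.
have := @indep_seq [:: inl n; inr n] B isT; rewrite big_cons big_seq1 => <-; last first.
  by case.
congr (P _); apply/seteqP; split => w /=.
  by move=> [hE hF] i; rewrite !inE => /orP[] /eqP ->.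
move=> h; split; first by apply: (h (inl n)); rewrite inE eqxx.
by apply: (h (inr n)); rewrite !inE eqxx.
Qed.

(** Shifted by one, so that pair [i] decides the report following a history of size [i]. *)
Definition signals i w := (s i.+1 w, V i.+1 w).

Lemma measurable_signals i : measurable_fun setT (signals i).
Proof. exact: measurable_fun_pair. Qed.

Lemma signals_indep (E F : nat -> set R) k :
  (forall i, measurable (E i)) -> (forall i, measurable (F i)) ->
  P (cylinder signals (fun i => E i `*` F i) k) =
  (\prod_(i < k) P (signals i @^-1` (E i `*` F i)))%E.
Proof.
move=> mE mF.
under eq_bigr => i _ do rewrite (_ : _ @^-1` _ = s i.+1 @^-1` E i `&` V i.+1 @^-1` F i)//
  indep_pair//.
rewrite big_split/=.
(* The predecessor undoes the shift in [signals]. *)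
pose B (i : nat + nat) := match i with inl n => E n.-1 | inr n => F n.-1 end.
pose rs : seq (nat + nat) := [seq inl i | i <- iota 1 k].
pose rV : seq (nat + nat) := [seq inr i | i <- iota 1 k].
have ur : uniq (rs ++ rV).
  rewrite cat_uniq !map_inj_uniq ?iota_uniq ?andbT//=; try by move=> ? ? [].
  by apply/hasPn => _ /mapP[i _ ->]; apply/mapP => -[].
have := @indep_seq (rs ++ rV) B ur; rewrite big_cat/= !big_map.
have iotaE (G : nat -> \bar R) : (\prod_(i <- iota 1 k) G i = \prod_(i < k) G i.+1)%E.
  rewrite -[1%N]addn0 iotaDl big_map -{1}[k]subn0.
  by rewrite [LHS](big_mkord xpredT (fun i => G (1 + i)%N)).
rewrite !iotaE/= => <-; last by case=> n; [exact: mE|exact: mF].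
congr (P _); apply/seteqP; split => w /= h i.
  by rewrite mem_cat => /orP[] /mapP[[|n]]; rewrite mem_iota// => nk -> /=; have [] := h n nk.
move=> ik; split.
  by apply: (h (inl i.+1)); rewrite mem_cat map_f// mem_iota.
by apply: (h (inr i.+1)); rewrite mem_cat orbC map_f// mem_iota.
Qed.

Definition hist w n := history (fun k => s k w) (fun k => V k w) n.

Definition history_event h := [set w | hist w (size h) = h].

Lemma history_event_cons b h : history_event (b :: h) =
  history_event h `&` signals (size h) @^-1` reports eps sigma (llr h) b.
Proof.
apply/seteqP; split => w; rewrite /history_event /reports /hist/=.
  by move=> [rb hh]; rewrite hh in rb; split.
by move=> [-> ->].
Qed.

(** Once the past reports are fixed, every public ratio is a number, so each report constrains a
    single pair. *)
Lemma history_event_cylinder h : exists2 B, (forall i, measurable (B i)) &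
  history_event h = cylinder signals B (size h).
Proof.
elim: h => [|b h [B mB hB]].
  exists (fun=> setT) => //; apply/seteqP; split => w //=.
exists (fun i => if i == size h then reports eps sigma (llr h) b else B i).
  by move=> i; case: ifP => // _; exact: measurable_reports.
rewrite history_event_cons cylinderS eqxx hB; congr (_ `&` _).
by apply/seteqP; split => w /= hw i ih; have := hw i ih; rewrite ltn_eqF.
Qed.

Lemma measurable_history_event h : measurable (history_event h).
Proof.
have [B mB ->] := history_event_cylinder h.
by apply: measurable_cylinder => //; exact: measurable_signals.
Qed.

(** The next pair is independent of the past, so given a history the next report follows [pact] at
    the ratio of that history. *)
Lemma prob_history_event_cons b h : P (history_event (b :: h)) =
  (P (history_event h) * (pact b 1 (llr h))%:E)%E.
Proof.
have [B mB hB] := history_event_cylinder h.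
rewrite history_event_cons hB cylinder_indep_next//.
- congr (_ * _)%E; apply: report_law => //.
  + exact: lawS.
  + exact: lawV.
  + exact: indep_pair.
- exact: measurable_signals.
- exact: signals_indep.
- exact: measurable_reports.
Qed.

(** Histories form a countable type, so the event is a countable union of history events. *)
Lemma measurable_hist (Q : seq bool -> bool) n : measurable [set w | Q (hist w n)].
Proof.
rewrite (_ : [set w | _] = \bigcup_h
    (if Q h && (size h == n) then history_event h else set0)).
  apply: countable_bigcupT_measurable => // h.
  by case: ifP => // _; exact: measurable_history_event.
apply/seteqP; split => w /=.
  move=> Qw; exists (hist w n) => //.
  by rewrite Qw size_history eqxx/= /history_event /= size_history.
by move=> [h _]; case: ifP => // /andP[Qh /eqP <-]; rewrite /history_event /= => ->.
Qed.

(** * Crossing probabilities of a supermartingale *)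

Variable Phi : nat -> R -> R.
Hypothesis Phi_ge0 : forall n l, 0 <= Phi n l.
Hypothesis Phi_drift : forall n l, (0 < n)%N -> Phi n l < 1 ->
  \sum_(b <- [:: true; false]) pact b 1 l * Phi n.+1 (l + incr l b) <= Phi n l.

(** A history of [m] reports goes with time [m.+1], as in [lpub_history]. *)
Definition crossing n k := [set w | exists2 m, (n <= m <= n + k)%N &
  1 <= Phi m.+1 (llr (hist w m))].

Lemma measurable_crossing n k : measurable (crossing n k).
Proof.
rewrite (_ : crossing n k = \bigcup_(m in [set m | (n <= m <= n + k)%N])
   [set w | 1 <= Phi m.+1 (llr (hist w m))]).
  apply: bigcup_measurable => m _.
  exact: (measurable_hist (fun h => 1 <= Phi m.+1 (llr h))).
by apply/seteqP; split => w [m hm hw]; exists m.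
Qed.

(* Ville's maximal inequality for the stopped process, by induction on the
   number of remaining steps. *)
Lemma crossing_le k h :
  (P (history_event h `&` crossing (size h) k) <=
   P (history_event h) * (Phi (size h).+1 (llr h))%:E)%E.
Proof.
(* If the level is already reached, the right-hand side is at least the probability of the
   history. *)
have crossing1 j g : 1 <= Phi (size g).+1 (llr g) ->
    (P (history_event g `&` crossing (size g) j) <=
     P (history_event g) * (Phi (size g).+1 (llr g))%:E)%E.
  move=> Phi1; apply: (@le_trans _ _ (P (history_event g))).
    apply: le_measure; rewrite ?inE//; last exact: measurable_history_event.
    apply: measurableI; [exact: measurable_history_event|exact: measurable_crossing].
  by rewrite -[leLHS]mule1; apply: lee_wpmul2l; rewrite ?lee_fin.
elim: k h => [|k ih] h; have [|Phi1] := leP 1 (Phi (size h).+1 (llr h)).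
- exact: crossing1.
- rewrite (_ : _ `&` _ = set0) ?measure0 ?mule_ge0 ?lee_fin//.
  apply/seteqP; split => w //= -[hw [m]]; rewrite addn0 -eqn_leq => /eqP <-.
  by rewrite hw leNgt Phi1.
- exact: crossing1.
(* The level is not yet reached, so a crossing happens after the next report; the two values of that
   report are treated separately, and [Phi_drift] recombines them. *)
- pose A b := history_event (b :: h) `&` crossing (size h).+1 k.
  have mA b : measurable (A b).
    by apply: measurableI; [exact: measurable_history_event|exact: measurable_crossing].
  have sub : history_event h `&` crossing (size h) k.+1 `<=` A true `|` A false.
    move=> w [hw [m /andP[hm mk] Phim]].
    have {}hm : (size h < m)%N.
      rewrite ltn_neqAle hm andbT; apply/eqP => hm'.
      by move: Phim; rewrite -hm' hw leNgt Phi1.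
    have cw : crossing (size h).+1 k w by exists m; rewrite // hm addSnnS.
    case: (boolP (hist w (size h).+1 == true :: h)) => [/eqP hb|]; first by left.
    move=> /eqP hb; right; split => //; move: hb; rewrite /history_event /hist /=.
    by move: hw; rewrite /history_event /hist /= => ->; case: report.
  apply: (@le_trans _ _ (P (A true `|` A false))).
    apply: le_measure; rewrite ?inE//; last exact: measurableU.
    by apply: measurableI; [exact: measurable_history_event|exact: measurable_crossing].
  apply: (le_trans (measureU2 _ (mA true) (mA false))).
  apply: (le_trans (leeD (ih (true :: h)) (ih (false :: h)))).
  rewrite !prob_history_event_cons -!muleA -muleDr//; last first.
    by rewrite fin_num_measure//; exact: measurable_history_event.
  apply: lee_wpmul2l => //; rewrite -!EFinM -EFinD lee_fin.
  by have := Phi_drift (ltn0Sn (size h)) Phi1; rewrite !big_cons big_nil addr0.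
Qed.

Definition ever_crossing := [set w | exists m, 1 <= Phi m.+1 (llr (hist w m))].

Lemma ever_crossingE : ever_crossing = \bigcup_k crossing 0 k.
Proof.
  apply/seteqP; split => w /=.
    by move=> [m hm]; exists m => //; exists m; rewrite //= add0n leqnn.
  by move=> [k _ [m _ hm]]; exists m.
Qed.

Lemma measurable_ever_crossing : measurable ever_crossing.
Proof.
by rewrite ever_crossingE; apply: bigcupT_measurable => k; exact: measurable_crossing.
Qed.

(** Continuity from below over the horizon [k], with [crossing_le] at the empty history. *)
Lemma ever_crossing_prob : (P ever_crossing <= (Phi 1 0)%:E)%E.
Proof.
have ndc : {homo crossing 0 : n m / (n <= m)%N >-> (n <= m)%O}.
  move=> n m nm; apply/subsetPset => w [i /andP[_ ni] hi]; exists i => //.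
  by rewrite leq0n/= (leq_trans ni).
have := measurable_ever_crossing; rewrite ever_crossingE => mc.
have cc := nondecreasing_cvg_mu (mu := P) (measurable_crossing 0) mc ndc.
rewrite -(cvg_lim _ cc)//; apply: lime_le.
  by apply/cvg_ex; exists (P (\bigcup_k crossing 0 k)).
near=> k; have := crossing_le k [::]; rewrite /= (_ : history_event [::] = setT).
  by rewrite setTI probability_setT mul1e.
by apply/seteqP; split.
Unshelve. all: by end_near. Qed.

End histories.

(** * Asymptotics *)

Lemma ratio_ln_cvg1 (R : realType) (u : nat -> R) :
  (forall r, 0 < r -> exists D, forall n, (0 < n)%N ->
    `|u n - ln n%:R| <= D + r * ln n%:R) ->
  u n / ln n%:R @[n --> \oo] --> (1 : R).
Proof.
move=> h; apply/cvgrPdist_le => e e0.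
have e20 : 0 < e / 2 by rewrite divr_gt0.
(* Half of the error [e] absorbs the slope [r]; the other half absorbs [D] once [ln n] exceeds
   [D / (e / 2)]. *)
have [D hD] := h _ e20; pose A := Num.max 1 (D / (e / 2)).
near=> n.
have A1 : 1 <= A by rewrite le_max lexx.
have nA : expR A <= n%:R by near: n; exact: nbhs_infty_ger.
have n0R : 0 < n%:R :> R by rewrite (lt_le_trans _ nA)// expR_gt0.
have AL : A <= ln n%:R by rewrite -ler_expR lnK.
have L0 : 0 < ln n%:R :> R by rewrite (lt_le_trans _ AL)// (lt_le_trans _ A1).
have n0 : (0 < n)%N by rewrite -(ltr0n R).
rewrite distrC -[X in _ - X](@divff _ (ln n%:R)) ?gt_eqF// -mulrBl normrM.
rewrite normfV (gtr0_norm L0) ler_pdivrMr// (le_trans (hD n n0))//.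
have : D <= e / 2 * ln n%:R.
  rewrite mulrC -ler_pdivrMr// (le_trans _ AL)//.
  by rewrite le_max lexx orbT.
lra.
Unshelve. all: by end_near. Qed.

Section asymptotics.
Context d (T : measurableType d) (R : realType) (P : probability T R).
Variables eps sigma : R.
Hypotheses (eps0 : 0 < eps) (sigma0 : 0 < sigma).
Local Notation kappa := (eps * sigma ^+ 2 / 2).

Let kappa0 : 0 < kappa.
Proof. by rewrite divr_gt0// mulr_gt0// exprn_gt0. Qed.

Lemma Cconst_gt0 : 0 < Cconst eps sigma.
Proof.
rewrite /Cconst mulr_gt0//; first by rewrite divr_gt0// mulr_gt0// exprn_gt0.
by rewrite subr_gt0 ltr_expR ltrD2r (lt_trans _ eps0)// oppr_lt0.
Qed.

Lemma fnE n : (0 < n)%N ->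
  fn eps sigma n = kappa^-1 * (ln (Cconst eps sigma) + ln n%:R).
Proof.
move=> n0; rewrite /fn lnM ?posrE ?Cconst_gt0 ?ltr0n//; congr (_ * _).
by rewrite invf_div.
Qed.

Lemma lnCn_ratio :
  (ln (Cconst eps sigma) + ln n%:R) / ln n%:R @[n --> \oo] --> (1 : R).
Proof.
apply: (@ratio_ln_cvg1 _ (fun n => ln (Cconst eps sigma) + ln n%:R)) => r r0.
exists `|ln (Cconst eps sigma)| => n n0; rewrite addrK lerDl mulr_ge0 ?(ltW r0)//.
by rewrite ln_ge0// ler1n.
Qed.

(** Iterating [expR_llr_step] gives linear growth of the exponential along every path, so [A] is
    uniform in [s] and [v]. *)
Lemma lpub_le : exists A, forall s v n, (0 < n)%N ->
  kappa * lpub eps sigma s v n - ln n%:R <= A.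
Proof.
have [K K0 KP] := expR_llr_step eps0 sigma0; exists (ln (1 + K)) => s v [//|n] _.
have K1 : 0 < 1 + K by rewrite addr_gt0.
have main : expR (kappa * lpub eps sigma s v n.+1) <= 1 + K * n%:R.
  rewrite lpub_history; elim: n => [|n ih].
    by rewrite [llr _ _ _]/= !mulr0 expR0 addr0.
  rewrite [history _ _ _ _ _]/= [llr _ _ _]/= (le_trans (KP _ _))//.
  by rewrite (le_trans (lerD ih (lexx K)))// -natr1 mulrDr mulr1 addrA.
rewrite lerBlDr -lnM ?posrE ?ltr0n// -ler_expR lnK ?posrE ?mulr_gt0 ?ltr0n//.
rewrite (le_trans main)// -natr1.
have : 0 <= n%:R :> R by [].
by move: (n%:R : R) => x x0; nra.
Qed.

Variables s V : nat -> {mfun T >-> R}.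
Hypothesis lawS : forall n B, measurable B -> P (s n @^-1` B) = normal_prob 1 sigma B.
Hypothesis lawV : forall n B, measurable B ->
  P (V n @^-1` B) = lebesgue_measure (B `&` `[0, 1]%classic).
Hypothesis indep : mutually_independent P
  (fun i : nat + nat => match i with inl n => (s n : T -> R) | inr n => (V n : T -> R) end).

Local Notation l w := (lpub eps sigma (fun k => s k w) (fun k => V k w)).

Lemma lpub_ge_ae (r : R) : 0 < r ->
  {ae P, forall w, exists D, forall n, (0 < n)%N ->
    ln n%:R - kappa * l w n <= D + r * ln n%:R}.
Proof.
move=> r0; pose good w := exists D, forall n, (0 < n)%N ->
  ln n%:R - kappa * l w n <= D + r * ln n%:R.
(* The complement of [good] lies in crossing events of probability at most [1 / (i + 1)], whose
   intersection is null. Off such an event [Phi] stays below 1, and one constant serves all [n]. *)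
have /choice[D DP] : forall i : nat, exists D, [/\ measurable D,
    (P D <= (i.+1%:R^-1)%:E)%E & ~` good `<=` D].
  move=> i; have delta0 : 0 < i.+1%:R^-1 :> R by rewrite invr_gt0 ltr0n.
  have [Phi [D [Phi10 Phi_ge0 Phi_drift PhiD]]] := stopping_potential eps0 sigma0 r0 delta0.
  exists (ever_crossing eps sigma s V Phi); split.
  - exact: measurable_ever_crossing.
  - apply: (le_trans (ever_crossing_prob eps0 lawS lawV indep Phi_ge0 Phi_drift)).
    by rewrite lee_fin.
  - move=> w; apply: contra_notP => Nw; exists D => -[//|n] _; apply: PhiD => //.
    by rewrite ltNge; apply/negP => h; apply: Nw; exists n; rewrite -lpub_history.
exists (\bigcap_i D i); split.
- by apply: bigcapT_measurable => i; have [] := DP i.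
- apply/eqP; rewrite eq_le measure_ge0 andbT; apply/lee_addgt0Pr => e e0.
  rewrite add0e; pose i := Num.trunc (e^-1).
  have [mD PD _] := DP i.
  apply: (@le_trans _ _ (P (D i))).
    apply: le_measure; rewrite ?inE//; last by move=> w; apply.
    by apply: bigcapT_measurable => j; have [] := DP j.
  rewrite (le_trans PD)// lee_fin invf_ple ?posrE ?ltr0n//.
  by rewrite ltW// truncnS_gt.
- by move=> w Nw i _; have [_ _] := DP i; apply.
Qed.

Lemma lpub_ratio_ae :
  {ae P, forall w, l w n / fn eps sigma n @[n --> \oo] --> (1 : R)}.
Proof.
have [A lA] := lpub_le.
(* The null set depends on the slope; the countably many slopes [1 / (j + 1)] allow a common one. *)
have : {ae P, forall w, forall j, exists D, forall n, (0 < n)%N ->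
    ln n%:R - kappa * l w n <= D + j.+1%:R^-1 * ln n%:R}.
  by apply: ae_foralln => j; apply: lpub_ge_ae; rewrite invr_gt0 ltr0n.
apply: filterS => w lw.
have ratio : kappa * l w n / ln n%:R @[n --> \oo] --> (1 : R).
  apply: (@ratio_ln_cvg1 _ (fun n => kappa * l w n)) => r r0.
  have [D hD] := lw (Num.trunc (r^-1)); exists (`|A| + `|D|) => n n0.
  have L0 : 0 <= ln n%:R :> R by rewrite ln_ge0// ler1n.
  have r1 : (Num.trunc r^-1).+1%:R^-1 <= r.
    by rewrite invf_ple ?posrE ?ltr0n// ltW// truncnS_gt.
  have := ler_wpM2r L0 r1; have := hD n n0; have := lA (fun k => s k w) (fun k => V k w) n n0.
  have := ler_norm A; have := ler_norm D; have := normr_ge0 A; have := normr_ge0 D.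
  have := mulr_ge0 (ltW r0) L0; rewrite ler_norml.
  move: (_^-1 * ln n%:R) (kappa * l w n) => y z; lra.
(* Both [kappa * l w n] and [kappa] times [fn] are asymptotic to [ln n]; the ratio is taken through
   [ln n]. *)
have lim1 : kappa * l w n / ln n%:R *
    ((ln (Cconst eps sigma) + ln n%:R) / ln n%:R)^-1 @[n --> \oo] --> (1 : R).
  by have := cvgM ratio (cvgV (oner_neq0 _) lnCn_ratio); rewrite invr1 mulr1; apply.
suff E : \forall n \near \oo, kappa * l w n / ln n%:R *
    ((ln (Cconst eps sigma) + ln n%:R) / ln n%:R)^-1 = l w n / fn eps sigma n.
  by apply: cvg_trans lim1; exact: near_eq_cvg.
near=> n.
have n1 : (1 < n)%N by near: n; exists 2%N.
have L0 : ln n%:R != 0 :> R by rewrite gt_eqF// ln_gt0// ltr1n.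
rewrite fnE ?(ltnW n1)// [(_ / ln _)^-1]invf_div mulrA divfK//.
move: (l w n) kappa (ln (Cconst eps sigma) + _) => x k q.
by rewrite invfM invrK mulrA [x * k]mulrC.
Unshelve. all: by end_near. Qed.

End asymptotics.

Theorem theorem6 (R : realType) (d : measure_display) (T : measurableType d)
  (P : probability T R) (eps sigma : R) (s V : nat -> {mfun T >-> R}) :
  0 < eps -> 0 < sigma ->
  (* conditional on theta = +1: signals i.i.d. N(1, sigma^2) *)
  (forall n B, measurable B -> P (s n @^-1` B) = normal_prob 1 sigma B) ->
  (* randomization variables i.i.d. uniform on [0,1] *)
  (forall n B, measurable B -> P (V n @^-1` B) = lebesgue_measure (B `&` `[0, 1])) ->
  (* all signals and randomizations mutually independent *)
  mutually_independent P
    (fun i : nat + nat => match i with inl n => (s n : T -> R) | inr n => (V n : T -> R) end) ->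
  {ae P, forall w,
     (fun n => lpub eps sigma (fun k => s k w) (fun k => V k w) n / fn eps sigma n)
       @ \oo --> (1 : R)} /\
  (fun n => fn eps sigma n / (2 / (eps * sigma ^+ 2) * ln (n%:R : R))) @ \oo --> (1 : R).
Proof.
move=> eps0 sigma0 lawS lawV indep; split; first exact: lpub_ratio_ae.
(* The factor [2 / (eps * sigma ^+ 2)] cancels, leaving [lnCn_ratio]; [n > 1] ensures [ln n] is
   nonzero. *)
suff E : \forall n \near \oo, (ln (Cconst eps sigma) + ln n%:R) / ln n%:R =
    fn eps sigma n / (2 / (eps * sigma ^+ 2) * ln (n%:R : R)).
  have lim := lnCn_ratio eps sigma.
  by apply: cvg_trans lim; exact: near_eq_cvg.
near=> n.
have n1 : (1 < n)%N by near: n; exists 2%N.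
have L0 : ln n%:R != 0 :> R by rewrite gt_eqF// ln_gt0// ltr1n.
by rewrite fnE ?(ltnW n1)//; field; rewrite L0 !gt_eqF.
Unshelve. all: by end_near. Qed.
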